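(* Let $p=2q+1\ge 3$ be an odd integer coprime to $3$, let $T=[(x_1,y_1),\dots,(x_q,y_q)]$ be a starter in $\mathbb{Z}_p$ (with its pairs and the elements inside pairs listed in some fixed order), and let $t\in\mathbb{Z}_p$. Let $\phi$ be the permutation of the set $\{0,1,2\}$ that transposes $1$ and $2$ (and fixes $0$). If the values $(U_i,V_i)_{i=0}^{3q}$ satisfy the constraints of the modular Sudoku problem associated with $(T,t)$, then the values $(\phi(U_i),\phi(V_i))_{i=0}^{3q}$ also satisfy those constraints.
   Context: Starters. For odd $n\ge 3$, $\mathbb{Z}_n=\mathbb{Z}/n\mathbb{Z}$ and $\mathbb{Z}_n^*=\mathbb{Z}_n\setminus\{0\}$. A starter in $\mathbb{Z}_n$ (of order $n$) is a partition of $\mathbb{Z}_n^*$ into $k=(n-1)/2$ pairs $\{a_i,b_i\}$, $i=1,\dots,k$, such that the differences $\pm(a_i-b_i)$, $i=1,\dots,k$, comprise all of $\mathbb{Z}_n^*$. Extension. Given $T=[(x_1,y_1),\dots,(x_q,y_q)]$ with entries in $\mathbb{Z}_p$, $p=2q+1$, and a key $t\in\mathbb{Z}_p$, the extension of $T$ with key $t$ is the tuple $\Sigma_p=[(u_i,v_i)]_{i=0}^{3q}$ of ordered pairs in $\mathbb{Z}_p$ given by $(u_0,v_0)=(t,t)$ and, for $1\le i\le q$, $(u_{3i-2},v_{3i-2})=(x_i,y_i)$, $(u_{3i-1},v_{3i-1})=(t+x_i,t+y_i)$, $(u_{3i},v_{3i})=(t-y_i,t-x_i)$. The three pairs with indices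 $3i-2,3i-1,3i$ form the $i$-th regular row. Weak sets. For $s\in\mathbb{Z}_p$ let $W_s=\{\ell\in\{0,\dots,3q\}: u_\ell+v_\ell=s \text{ in }\mathbb{Z}_p\}$. $W_s$ is called a weak set if $s=0$ or $|W_s|>1$. Monochrome sets. The position $\langle i,0\rangle$ refers to the entry $u_i$ and $\langle i,1\rangle$ to the entry $v_i$, $0\le i\le 3q$. For $c\in\mathbb{Z}_p$ the monochrome set $M_c$ is the set of positions whose entry in $\Sigma_p$ equals $c$. Modular Sudoku problem associated with $(T,t)$: find $U_i,V_i\in\{0,1,2\}$, $0\le i\le 3q$ (regarded as residues modulo $3$, with $U_i$ in position $\langle i,0\rangle$ and $V_i$ in position $\langle i,1\rangle$), such that: (1) Row constraints: for each $i=1,\dots,q$ the differences $U_j-V_j \bmod 3$, $j=3i-2,3i-1,3i$, are pairwise distinct. (2) Weak set constraints: for each weak set $W_s$ with $s\ne0$, the sums $U_i+V_i\bmod 3$, $i\in W_s$, are pairwise distinct; and the sums $U_i+V_i\bmod 3$, $i\in W_0$, are pairwise distinct and nonzero. (3) Color constraints: for each $c\in\mathbb{Z}_p$, $c\neq0$, the values of the unknowns in the positions belonging to $M_c$ are pairwise distinct; and the values of the unknowns in the positions belonging to $M_0$ are pairwise distinct and nonzero. *)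

(* Defs.v *)
From mathcomp Require Import all_boot all_fingroup all_algebra.
Set Implicit Arguments. Unset Strict Implicit. Unset Printing Implicit Defensive.
Import GRing.Theory.
Local Open Scope ring_scope.

(* T lists, in some order, the pairs of a starter of order n = 2k+1: its
   2-element sets {x_i, y_i} are distinct and partition Z_n \ {0}, and the
   differences +-(x_i - y_i) comprise all of Z_n \ {0}.
   'Z_n is Z/nZ only for n > 1. *)
Definition starter (n k : nat) (T : k.-tuple ('Z_n * 'Z_n)) : Prop :=
  let x i := (tnth T i).1 in
  let y i := (tnth T i).2 in
  [/\ forall i, x i != y i,
      injective (fun i => [set x i; y i]),
      partition [set [set x i; y i] | i : 'I_k] [set~ 0]
    & [set x i - y i | i : 'I_k] :|: [set - (x i - y i) | i : 'I_k] = [set~ 0]].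

Section Extension.
Variables (p q : nat) (T : q.-tuple ('Z_p * 'Z_p)) (t : 'Z_p).

Definition regular_row (xy : 'Z_p * 'Z_p) : seq ('Z_p * 'Z_p) :=
  [:: (xy.1, xy.2); (t + xy.1, t + xy.2); (t - xy.2, t - xy.1)].

Definition extension_seq : seq ('Z_p * 'Z_p) :=
  (t, t) :: flatten [seq regular_row xy | xy <- T].

Lemma size_extension_seq : size extension_seq == (3 * q).+1.
Proof.
rewrite /extension_seq /= -{2}(size_tuple T) eqSS.
by elim: (val T) => [|xy s IHs] //=; rewrite mulnS -(eqP IHs).
Qed.

Definition extension : (3 * q).+1.-tuple ('Z_p * 'Z_p) :=
  Tuple size_extension_seq.

Definition sum_set (s : 'Z_p) : {set 'I_(3 * q).+1} :=
  [set l | (tnth extension l).1 + (tnth extension l).2 == s].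

Definition weak (s : 'Z_p) : bool := (s == 0) || (1 < #|sum_set s|)%N.

(* Position <i,0> is (i, false) and position <i,1> is (i, true). *)
Definition position : finType := ('I_(3 * q).+1 * bool)%type.

Definition entry (A : Type) (uv : A * A) (b : bool) : A :=
  if b then uv.2 else uv.1.

Definition monochrome (c : 'Z_p) : {set position} :=
  [set P | entry (tnth extension P.1) P.2 == c].

(* The index set of the i-th regular row, meant for 1 <= i <= q. *)
Definition row_indices (i : nat) : {set 'I_(3 * q).+1} :=
  [set j | nat_of_ord j \in [:: 3 * i - 2; 3 * i - 1; 3 * i]%N].

Section Constraints.
Variables U V : 'I_(3 * q).+1 -> 'Z_3.

Definition unknown (P : position) : 'Z_3 := entry (U P.1, V P.1) P.2.

Definition row_constraints : Prop :=
  forall i : nat, (1 <= i <= q)%N ->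
    {in row_indices i &, injective (fun j => U j - V j)}.

Definition weak_set_constraints : Prop :=
  [/\ forall s, weak s -> s != 0 ->
        {in sum_set s &, injective (fun i => U i + V i)},
      {in sum_set 0 &, injective (fun i => U i + V i)}
    & {in sum_set 0, forall i, U i + V i != 0}].

Definition color_constraints : Prop :=
  [/\ forall c, c != 0 -> {in monochrome c &, injective unknown},
      {in monochrome 0 &, injective unknown}
    & {in monochrome 0, forall P, unknown P != 0}].

Definition modular_sudoku : Prop :=
  [/\ row_constraints, weak_set_constraints & color_constraints].

End Constraints.
End Extension.

Definition phi : {perm 'Z_3} := tperm 1 2.

(* Main.v *)
Require Import Defs.
From mathcomp Require Import all_boot all_fingroup all_algebra.
Set Implicit Arguments. Unset Strict Implicit. Unset Printing Implicit Defensive.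

(** The transposition of 1 and 2 is negation modulo 3 ([phiE]).  Negation is
    additive, so it sends each difference [U j - V j], each sum [U i + V i] and
    each single unknown to its opposite; and being a bijection of Z_3 that fixes
    0, it preserves pairwise distinctness ([inj_in_opp]) and nonvanishing.
    Every constraint of the problem is one of these two conditions on one of
    these three quantities, so each constraint is preserved separately.  *)

Import GRing.Theory.
Local Open Scope ring_scope.

Lemma phiE (x : 'Z_3) : phi x = - x.
Proof.
apply/eqP; rewrite /phi permE /=.
by case: x => [[|[|[|m]]] ltm].
Qed.

Lemma inj_in_opp (I : finType) (G : zmodType) (A : {set I}) (f g : I -> G) :
  (forall i, g i = - f i) -> {in A &, injective f} -> {in A &, injective g}.
Proof.
by move=> gE injf i j Ai Aj; rewrite !gE => /oppr_inj; apply: injf.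
Qed.

Lemma neq0_in_opp (I : finType) (G : zmodType) (A : {set I}) (f g : I -> G) :
  (forall i, g i = - f i) ->
  {in A, forall i, f i != 0} -> {in A, forall i, g i != 0}.
Proof. by move=> gE f0 i Ai; rewrite gE oppr_eq0 f0. Qed.

Local Close Scope ring_scope.

Theorem theorem3 (p q : nat) (hp : p = (2 * q + 1)%N) (hp3 : (3 <= p)%N)
    (hcop : coprime p 3) (T : q.-tuple ('Z_p * 'Z_p)) (hT : starter T)
    (t : 'Z_p) (U V : 'I_(3 * q).+1 -> 'Z_3) :
  modular_sudoku T t U V ->
  modular_sudoku T t (fun i => phi (U i)) (fun i => phi (V i)).
Proof.
have diffE i : (phi (U i) - phi (V i) = - (U i - V i))%R.
  by rewrite !phiE opprD.
have sumE i : (phi (U i) + phi (V i) = - (U i + V i))%R.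
  by rewrite !phiE opprD.
have unknownE P :
    unknown (fun i => phi (U i)) (fun i => phi (V i)) P = (- unknown U V P)%R.
  by case: P => i []; rewrite /unknown /= phiE.
case=> rowC [weakC weak0 weak_neq0] [colC col0 col_neq0]; split.
- by move=> i /rowC; apply: inj_in_opp.
- split; first by move=> s ws /(weakC s ws); apply: inj_in_opp.
    exact: inj_in_opp weak0.
  exact: neq0_in_opp weak_neq0.
- split; first by move=> c /colC; apply: inj_in_opp.
    exact: inj_in_opp col0.
  exact: neq0_in_opp col_neq0.
Qed.
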